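(* Let $m_1,\ldots,m_r$ be a finite sequence of pairwise co-prime integers greater than $1$. For each $i\in\{1,\ldots,r\}$, let $\Sigma_{m_i}$ be the $m_i$-adic solenoid. Then the product $\Sigma=\Sigma_{m_1}\times\cdots\times\Sigma_{m_r}$ has the fupcon property.
   Context: A continuum is a nonempty compact connected metric space; a subcontinuum of a space is a subset which is a continuum. $S^1$ is the unit circle, viewed as the complex numbers of modulus $1$. For an integer $m\geq 2$, the $m$-adic solenoid $\Sigma_m$ is the inverse limit of the inverse sequence whose spaces are all $S^1$ and whose bonding maps are all $z\mapsto z^m$, i.e. $\Sigma_m=\{(z_1,z_2,\ldots)\in (S^1)^{\mathbb{N}} : z_{n+1}^m=z_n \text{ for all } n\}$ with the subspace topology of the product. Fupcon property (''full projection implies arbitrary small connected open neighborhoods''): given a family of metric continua $\{X_\alpha:\alpha\in J\}$, the product $X=\prod_{\alpha\in J}X_\alpha$, with projections $\pi_\alpha:X\to X_\alpha$, has the fupcon property provided that for every subcontinuum $M$ of $X$ and every open subset $U$ of $X$ such that $M\subset U$ and $\pi_\alpha(M)=X_\alpha$ for each $\alpha\in J$, there exists an open connected subset $V$ of $X$ such that $M\subset V\subset U$. Here the property refers to the product of the $r$ factors $\Sigma_{m_1},\ldots,\Sigma_{m_r}$. *)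

(* Defs.v *)
From HB Require Import structures.
From mathcomp Require Import all_boot all_order all_algebra.
From mathcomp Require Import complex.
From mathcomp Require Import all_classical all_reals all_analysis.

Set Implicit Arguments.
Unset Strict Implicit.
Unset Printing Implicit Defensive.

Import Order.TTheory GRing.Theory Num.Theory.
Import numFieldNormedType.Exports.

Local Open Scope classical_set_scope.
Local Open Scope complex_scope.
Local Open Scope ring_scope.

Definition metrizable (R : realType) (T : topologicalType) : Prop :=
  exists d : T -> T -> R,
    [/\ forall x y, d x y = 0 <-> x = y,
        forall x y, d x y = d y x,
        forall x y z, d x z <= d x y + d y z
      & forall x, nbhs x =
          filter_from [set e : R | 0 < e] (fun e => [set y | d x y < e])].

(* [compact M] and [connected M] are relative notions, so they coincide with
   compactness and connectedness of the subspace [set_type M]. *)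
Definition subcontinuum (R : realType) (T : topologicalType) (M : set T) :
    Prop :=
  [/\ M !=set0, compact M, connected M & metrizable R (set_type M)].

(* [X] is meant to be a family of continua; [R] is the field in which the
   metrics of subcontinua take their values. *)
Definition fupcon (R : realType) (J : Type) (X : J -> topologicalType) : Prop :=
  forall M U : set (prod_topology X),
    subcontinuum R M -> open U -> M `<=` U ->
    (forall j, proj j @` M = [set: X j]) ->
    exists V : set (prod_topology X),
      [/\ open V, connected V, M `<=` V & V `<=` U].

(* [R[i]^o] carries the topology given by the complex modulus. *)
Definition circle (R : realType) : set R[i]^o := [set z | `|z| = 1].
Arguments circle : clear implicits.

(* Sequences are indexed from 0. *)
Definition solenoid_set (R : realType) (m : nat) :
    set {ptws nat -> set_type (circle R)} :=
  [set z | forall n, set_val (z n.+1) ^+ m = set_val (z n)].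
Arguments solenoid_set : clear implicits.

Definition solenoid (R : realType) (m : nat) : topologicalType :=
  set_type (solenoid_set R m).

(* Main.v *)
(* The product S of the solenoids is a compact abelian group, carrying a flow
   [phi : R^r -> S] and subgroups [K n] (points whose coordinates of index n
   are 1); the boxes [x + phi (ball eps) + K n] are a base of neighborhoods.
   By compactness of M, some tube T = M + phi (ball eps) + K n lies in U.  Let
   V be the component of T containing M, and H the stabilizer of V in K n.
   Then V = M + phi (ball eps) + H, so it is enough that H contains some K j.
   Going along M in small steps and using compactness again, M lies in
   x0 + phi (ball A) + H for some A.  Since M projects onto each factor, the
   i-th projection of K n is covered by finitely many translates of the i-th
   projection of H.  As the m_i are pairwise coprime, the Chinese remainder
   theorem gives multiples of any h in H converging to its i-th component, so
   H, being closed, contains its projections; these are closed of finite index,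
   hence open, and so is H in K n. *)
Require Import Defs.
From HB Require Import structures.
From mathcomp Require Import all_boot all_order all_algebra.
From mathcomp Require Import complex.
From mathcomp Require Import all_classical all_reals all_analysis.
From mathcomp Require Import zify lra.

Set Implicit Arguments.
Unset Strict Implicit.
Unset Printing Implicit Defensive.

Import Order.TTheory GRing.Theory Num.Theory.
Import numFieldNormedType.Exports.

Local Open Scope classical_set_scope.
Local Open Scope complex_scope.
Local Open Scope ring_scope.

(** * Norms of rows, initial and product topologies, connectedness *)

Lemma row_entry_le_norm (R : realType) r (s : 'rV[R]_r) i : `|s 0 i| <= `|s|.
Proof.
rewrite [leRHS]/Num.norm/= mx_normrE.
exact: (le_bigmax _ (fun ij => `|s ij.1 ij.2|) (0, i)).
Qed.

Lemma cvg_initial_topology (S : choiceType) (T : topologicalType) (f : S -> T)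
    (F : set_system S) (s : S) : Filter F ->
  f @ F --> f s -> F --> (s : initial_topology f).
Proof.
move=> FF Ffs A /= [_ [[B oB <-] Bfs] BA].
by apply: filterS BA _; apply: Ffs; exact: open_nbhs_nbhs.
Qed.

Lemma cvg_prod_topology (I : Type) (T : I -> topologicalType)
    (F : set_system (prod_topology T)) (x : prod_topology T) : Filter F ->
  (forall i, (fun y => y i) @ F --> x i) -> F --> x.
Proof.
by move=> FF Fx; apply/cvg_sup => i; apply: cvg_initial_topology; exact: Fx.
Qed.

(** A nonempty relatively clopen part of [B] meets [A] by density, so it contains [A]; being
    relatively closed, it contains [B]. *)
Lemma connected_between_closure (T : topologicalType) (A B : set T) :
  connected A -> A `<=` B -> B `<=` closure A -> connected B.
Proof.
move=> cA AB BA U [z Uz] [C oC UC] [D cD UD].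
have AU : A `&` U = A.
  apply: cA.
  - move: (Uz); rewrite UC => -[/BA clz Cz].
    have [w [Aw Cw]] := clz _ (open_nbhs_nbhs (conj oC Cz)).
    by exists w; split=> //; split=> //; exact: AB.
  - by exists C => //; rewrite UC setIA (setIidl AB).
  - by exists D => //; rewrite UD setIA (setIidl AB).
rewrite UD; apply/setIidl => b /BA clb.
rewrite (closure_id D).1//; apply: closureS clb.
by move: AU; rewrite UD => <- x [_ []].
Qed.

(** * Abelian groups that are locally a cube times a subgroup *)

Section LocalProduct.
Variables (R : realType) (r : nat) (G : PreTopologicalZmodule.type).
Variables (phi : {additive 'rV[R]_r -> G}) (K : nat -> set G).
Variable e : 'I_r -> {additive G -> G}.

Hypothesis K0 : forall n, K n 0.
Hypothesis KB : forall n x y, K n x -> K n y -> K n (x - y).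
Hypothesis Kanti : forall n k, (n <= k)%N -> K k `<=` K n.
Hypothesis nbhs_localP : forall (x : G) (O : set G), nbhs x O <->
  exists n (eps : R), 0 < eps /\
    forall (s : 'rV[R]_r) k, `|s| < eps -> K n k -> O (x + phi s + k).
Hypothesis eK : forall i n x, K n x -> K n (e i x).
Hypothesis sum_e : forall x, x = \sum_i e i x.
(* This is where coprimality enters. *)
Hypothesis e_mulrn : forall i n k h, K n h -> exists N, K k (e i h - h *+ N).
(** Bounded flow times return to [K n] at finitely many points of each factor; this yields the
    finite cover by cosets of [stab]. *)
Hypothesis e_phi_finite : forall i n (A : R), exists F : seq G,
  forall s : 'rV[R]_r, `|s| < A -> K n (e i (phi s)) -> e i (phi s) \in F.

Lemma KN n x : K n x -> K n (- x).
Proof. by move=> Kx; rewrite -sub0r; apply: KB. Qed.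

Lemma KD n x y : K n x -> K n y -> K n (x + y).
Proof. by move=> Kx Ky; rewrite -[y]opprK; apply: KB => //; apply: KN. Qed.

Definition box (eps : R) n (x : G) : set G :=
  [set y | exists (s : 'rV[R]_r) k, [/\ `|s| < eps, K n k & y = x + phi s + k]].

Lemma nbhs_box eps n x : 0 < eps -> nbhs x (box eps n x).
Proof.
by move=> e0; apply/nbhs_localP; exists n, eps; split=> // s k ? ?; exists s, k.
Qed.

Lemma box_center eps n x : 0 < eps -> box eps n x x.
Proof.
by move=> e0; exists 0, 0; rewrite normr0 raddf0 !addr0; split.
Qed.

(** The structure on [G] does not tie addition to the topology; the link is [nbhs_localP]. *)
Lemma continuous_translation a : continuous (fun x : G => a + x).
Proof.
move=> x O /nbhs_localP[n [eps [e0 HO]]]; apply/nbhs_localP.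
by exists n, eps; split=> // s k se Kk /=; rewrite !addrA; apply: HO.
Qed.

Lemma connected_translate a (A : set G) :
  connected A -> connected [set a + x | x in A].
Proof.
move=> cA; apply: connected_continuous_connected => //.
exact/continuous_subspaceT/continuous_translation.
Qed.

Lemma connected_plaque x (s : 'rV[R]_r) :
  connected [set x + phi (t *: s) | t in `[0 : R, 1]%classic].
Proof.
apply: connected_continuous_connected; first exact: segment_connected.
apply: continuous_subspaceT => t O /nbhs_localP[n [eps [e0 HO]]].
(* The [+ 1] keeps the denominator positive when [s] is zero. *)
have d0 : 0 < eps / (`|s| + 1) by rewrite divr_gt0// ltr_wpDl.
suff : \forall u \near t, O (x + phi (u *: s)) by [].
near=> u.
have -> : x + phi (u *: s) = x + phi (t *: s) + phi ((u - t) *: s) + 0.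
  by rewrite addr0 -addrA -raddfD -scalerDl addrCA subrr addr0.
apply: HO => //; rewrite normrZ distrC.
have ut : `|t - u| < eps / (`|s| + 1) by near: u; exact: (nbhsx_ballx t _ d0).
apply: le_lt_trans (_ : `|t - u| * (`|s| + 1) < _).
  by rewrite ler_wpM2l// lerDl.
by rewrite -ltr_pdivlMr// ltr_wpDl.
Unshelve. all: by end_near. Qed.

Lemma compact_box_subset (M U : set G) : compact M -> open U -> M `<=` U ->
  exists n (eps : R), 0 < eps /\ forall x, M x -> box eps n x `<=` U.
Proof.
move=> /compact_near_coveringP cM oU MU.
(* One index controls both the radius and the subgroup, so a single bound comes out of
   compactness. *)
have : \forall n \near \oo, M `<=` [set x | box n.+1%:R^-1 n x `<=` U].
  apply: cM => x /MU Ux.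
  have /nbhs_localP[n [eps [e0 HU]]] : nbhs x U by apply: open_nbhs_nbhs.
  (* Half the radius is spent on going from [x] to [y], half on the box around [y]. *)
  have e20 : 0 < eps / 2 by rewrite divr_gt0.
  near=> y j => /= _ [s [k [sj Kk ->]]].
  have [t [l [tj Kl ->]]] : box (eps / 2) n x y by near: y; exact: nbhs_box.
  have -> : x + phi t + l + phi s + k = x + phi (t + s) + (l + k).
    by rewrite raddfD !addrA (addrAC _ l (phi s)).
  have nj : (n <= j)%N by near: j; exact: nbhs_infty_ge.
  apply: HU; last by apply: KD => //; exact: Kanti Kk.
  apply: le_lt_trans (ler_normD _ _) _.
  rewrite [eps]splitr ltrD//; apply: lt_trans sj _.
  by near: j; exact: near_infty_natSinv_lt (PosNum e20).
move=> [N _ /(_ N)] /= HN; exists N, N.+1%:R^-1; split=> //.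
by move=> x Mx; apply: HN => //=.
Unshelve. all: by end_near. Qed.

Lemma local_constancy (M P : set G) eps n : 0 < eps -> connected M ->
  (forall x y, M x -> M y -> box eps n x y -> P x <-> P y) ->
  M `&` P !=set0 -> M `<=` P.
Proof.
move=> e0 cM MP M0.
(* Boxes are only known to be neighborhoods of their centers, hence the interiors. The parts of [M]
   inside and outside [P] are both traces of such open sets, so they are clopen in [M]. *)
pose C (Q : set G) := \bigcup_(x in M `&` Q) (box eps n x)°.
have oC Q : open (C Q) by apply: bigcup_open => x _; exact: open_interior.
have CE Q : (forall x y, M x -> M y -> box eps n x y -> Q x <-> Q y) ->
    M `&` Q = M `&` C Q.
  move=> HQ; apply/seteqP; split=> [x [Mx Qx]|y [My [x [Mx Qx]]]].
    by split=> //; exists x => //; exact: nbhs_box.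
  by move=> /interior_subset /HQ h; split=> //; apply/h.
have := cM _ M0; rewrite -setIidPl; apply.
  by exists (C P); [exact: oC|exact: CE].
exists (~` C (~` P)); first exact: open_closedC.
apply/seteqP; split=> [x [Mx Px]|x [Mx nC]]; split=> //.
  case=> y [My nPy] /interior_subset yx; apply: nPy.
  exact/(MP _ _ My Mx yx).
apply: contrapT => nPx; apply: nC.
have /seteqP[/(_ x) h _] : M `&` ~` P = M `&` C (~` P).
  by apply: CE => u v Mu Mv uv; have h := MP u v Mu Mv uv; split=> nP Q;
    apply: nP; apply/h.
by have [] := h (conj Mx nPx).
Qed.

(** * The tube around [M], its component and the stabilizer *)

Section Component.
Variables (M : set G) (x0 : G) (n : nat) (eps : R).
Hypotheses (eps0 : 0 < eps) (cM : connected M) (Mx0 : M x0).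

Definition tube : set G := [set y | exists2 x, M x & box eps n x y].

Definition tube_component : set G := connected_component tube x0.
Local Notation V := tube_component.

(** Testing one point suffices: translations by [K n] preserve the tube, hence permute its
    components. [stabP] allows any other base point in [V]. *)
Definition stab : set G := [set k | K n k /\ V (k + x0)].

Lemma tube_component_sub : V `<=` tube.
Proof. exact: connected_component_sub. Qed.

Lemma sub_tube_component : M `<=` V.
Proof.
by apply: connected_component_max => // x Mx; exists x => //; exact: box_center.
Qed.

Lemma tube_translate k y : K n k -> tube y -> tube (k + y).
Proof.
move=> Kk [x Mx [s [l [se Kl ->]]]]; exists x => //; exists s, (k + l).
by split=> //; [exact: KD|rewrite addrCA !addrA].
Qed.

Lemma tube_component_absorb (A : set G) y : V y -> A y -> A `<=` tube ->
  connected A -> A `<=` V.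
Proof.
move=> Vy Ay At cA.
rewrite /tube_component (same_connected_component Vy).
exact: connected_component_max.
Qed.

(** The translate of [V] by [k] is a connected part of the tube that shares [k + y] with [V], so [V]
    absorbs it. *)
Lemma tube_component_translate k y z : K n k -> V y -> V (k + y) -> V z ->
  V (k + z).
Proof.
move=> Kk Vy Vky Vz.
apply: (@tube_component_absorb [set k + x | x in V] (k + y)) => //.
- by exists y.
- by move=> _ [x Vx <-]; apply: tube_translate => //; exact: tube_component_sub.
- exact/connected_translate/component_connected.
- by exists z.
Qed.

Lemma stabP k z : V z -> stab k <-> K n k /\ V (k + z).
Proof.
move=> Vz; split=> -[Kk Vk]; split=> //.
  by apply: tube_component_translate Vk Vz => //; exact: sub_tube_component.
by apply: tube_component_translate Vk _ => //; exact: sub_tube_component.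
Qed.

Lemma stab0 : stab 0.
Proof. by split=> //; rewrite add0r; exact: sub_tube_component. Qed.

Lemma stabD h k : stab h -> stab k -> stab (h + k).
Proof.
move=> [Kh Vh] [Kk Vk]; split; first exact: KD.
by rewrite -addrA; apply: tube_component_translate Vh Vk => //;
  exact: sub_tube_component.
Qed.

Lemma stabN h : stab h -> stab (- h).
Proof.
move=> [Kh Vh]; apply/(stabP _ Vh).
by split; [exact: KN|rewrite addKr; exact: sub_tube_component].
Qed.

Lemma stab_mulrn h N : stab h -> stab (h *+ N).
Proof.
move=> Hh; elim: N => [|N IH]; first exact: stab0.
by rewrite mulrS; exact: stabD.
Qed.

(* The segment from [k + x] to [x + phi s + k] stays in the tube, so the two
   points lie in the same component. *)
Lemma tube_component_boxP x s k : M x -> `|s| < eps -> K n k ->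
  V (x + phi s + k) <-> stab k.
Proof.
move=> Mx se Kk.
pose A := [set k + y | y in [set x + phi (t *: s) | t in `[0 : R, 1]%classic]].
have cA : connected A by exact/connected_translate/connected_plaque.
have At : A `<=` tube.
  move=> _ [_ [u + <-] <-]; rewrite /= in_itv/= => /andP[u0 u1].
  exists x => //; exists (u *: s), k; split=> //; last by rewrite addrC.
  by apply: le_lt_trans se; rewrite normrZ ger0_norm// ler_piMl.
have A0 : A (k + x).
  exists x => //; exists 0; rewrite /= ?in_itv/= ?lexx ?ler01//.
  by rewrite scale0r raddf0 addr0.
have A1 : A (x + phi s + k).
  rewrite addrC; exists (x + phi s) => //; exists 1.
    by rewrite /= in_itv/= lexx ler01.
  by rewrite scale1r.
have Vx := sub_tube_component Mx.
split=> [Vs|/(stabP _ Vx)[_ Vk]].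
  apply/(stabP _ Vx); split=> //.
  exact: tube_component_absorb Vs A1 At cA _ _.
exact: tube_component_absorb Vk A0 At cA _ _.
Qed.

(** The point [k + x0] lies in the tube and is a limit of points [h + x0] of [V]; adjoining it keeps
    [V] connected, so [V] already contains it. *)
Lemma stab_closed k : (forall j, exists2 h, stab h & K j (h - k)) -> stab k.
Proof.
move=> Hk.
have Kk : K n k.
  by have [h [Kh _] /(KB Kh)] := Hk n; rewrite subKr.
split=> //; pose A := V `|` [set k + x0].
have cA : connected A.
  apply: (@connected_between_closure _ V); first exact: component_connected.
    by move=> y Vy; left.
  move=> y [Vy|->]; first exact: subset_closure.
  move=> O /nbhs_localP[j [d [d0 HO]]].
  have [h [Kh Vh] Kj] := Hk j; exists (h + x0); split=> //.
  have -> : h + x0 = k + x0 + phi 0 + (h - k).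
    by rewrite raddf0 addr0 [RHS]addrC addrA subrK.
  by apply: HO => //; rewrite normr0.
have Vx0 := sub_tube_component Mx0.
apply: (@tube_component_absorb A x0) => //; [by left| |by right].
move=> y [/tube_component_sub//|->]; apply: tube_translate => //.
exact: tube_component_sub.
Qed.

Lemma stab_e i h : stab h -> stab (e i h).
Proof.
move=> Hh; apply: stab_closed => j.
have [N HN] := e_mulrn i j (proj1 Hh).
exists (h *+ N); first exact: stab_mulrn.
by rewrite -opprB; exact: KN.
Qed.

(** Being reachable from [x0] by the flow and [stab] is locally constant on [M]. A bound on the flow
    time at one point holds nearby up to [eps], so compactness makes it uniform. *)
Lemma bounded_orbit : compact M -> exists A : R, forall x, M x ->
  exists (s : 'rV[R]_r) h, [/\ `|s| < A, stab h & x = x0 + phi s + h].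
Proof.
move=> /compact_near_coveringP kM.
pose P x := exists (s : 'rV[R]_r) h, stab h /\ x = x0 + phi s + h.
(* Both ends lie in [V], which forces the [K n] part of a small step into [stab]. *)
have step x y : M x -> M y -> box eps n x y ->
    exists s h, [/\ `|s| < eps, stab h & y = x + phi s + h].
  move=> Mx My [s [k [se Kk yE]]]; exists s, k; split=> //.
  apply/(tube_component_boxP Mx se Kk); rewrite -yE.
  exact: sub_tube_component.
have stepE x s h t l : x = x0 + phi s + h ->
    x + phi t + l = x0 + phi (s + t) + (h + l).
  by move=> ->; rewrite raddfD !addrA (addrAC _ h (phi t)).
have MP : M `<=` P.
  apply: (local_constancy eps0 cM); last first.
    exists x0; split=> //; exists 0, 0.
    by split; [exact: stab0|rewrite raddf0 !addr0].
  move=> x y Mx My /(step _ _ Mx My)[t [l [te Hl yE]]]; split.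
    move=> [s [h [Hh xE]]]; exists (s + t), (h + l).
    by split; [exact: stabD|rewrite yE; exact: stepE].
  move=> [s [h [Hh /stepE xE]]]; exists (s - t), (h - l).
  split; first exact: (stabD Hh (stabN Hl)).
  by rewrite -xE yE raddfN addrAC addrK addrK.
(* The covering form of compactness ranges over all points of [G] near [x], hence the guard
   [M x]. *)
have : \forall N \near \oo, M `<=` [set x | M x -> exists (s : 'rV[R]_r) h,
    [/\ `|s| < N%:R, stab h & x = x0 + phi s + h]].
  apply: kM => x Mx; have [s [h [Hh xE]]] := MP _ Mx.
  near=> y N => /= My.
  have [|t [l [te Hl yE]]] := step x y Mx My; first by near: y; exact: nbhs_box.
  exists (s + t), (h + l); split; last by rewrite yE; exact: stepE.
  - apply: le_lt_trans (ler_normD _ _) _.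
    apply: lt_le_trans (_ : `|s| + eps <= _); first by rewrite ltrD2l.
    by near: N; exact: nbhs_infty_ger.
  - exact: stabD.
move=> [N _ /(_ N (leqnn N)) HN]; exists N%:R => x Mx; exact: HN.
Unshelve. all: by end_near. Qed.

(** * Openness of the stabilizer and of the component *)

Hypothesis fullM : forall i x, exists2 y, M y & e i y = e i x.
Hypothesis kM : compact M.

Lemma stab_open_factor i : exists j, forall k, K j k -> K n k -> stab (e i k).
Proof.
have [A HA] := bounded_orbit kM.
have [F HF] := e_phi_finite i n A.
(* Some point of [M] has the same [i]-th part as [k + x0]; its bounded orbit representation writes
   [e i k] as one of finitely many flow points plus an element of [stab]. *)
have cover k : K n k -> exists z, [/\ z \in F, K n z & stab (e i k - z)].
  move=> Kk; have [y My yE] := fullM i (k + x0).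
  have [s [h [sA Hh yE']]] := HA y My.
  have kE : e i k = e i (phi s) + e i h.
    apply: (addIr (e i x0)); rewrite -[LHS]raddfD -yE yE' !raddfD.
    by rewrite -addrA [LHS]addrC.
  have Ks : K n (e i (phi s)).
    have -> : e i (phi s) = e i k - e i h by rewrite kE addrK.
    by apply: KB; [exact: eK|apply: eK; exact: (proj1 Hh)].
  exists (e i (phi s)); split=> //; first exact: HF.
  by rewrite kE addrC addKr; exact: stab_e.
(* Since [stab] is closed, finitely many of its translates that avoid 0 also
   avoid some [K j]. *)
have sep z : exists j, K n z -> (exists h, stab h /\ K j (h - z)) -> stab z.
  have [Hz|nHz] := pselect (stab z); first by exists 0%N.
  have [j Hj] : exists j, ~ exists h, stab h /\ K j (h - z).
    apply: contrapT => H; apply: nHz; apply: stab_closed => j.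
    apply: contrapT => Hj; apply: H; exists j => -[h [Hh Kh]].
    by apply: Hj; exists h.
  by exists j.
have {sep}[J HJ] : exists J : G -> nat, forall z, K n z ->
    (exists h, stab h /\ K (J z) (h - z)) -> stab z.
  by have [J HJ] := choice sep; exists J.
exists (\max_(z <- F) J z)%N => k Kj Kk.
have [z [zF Kz Hz]] := cover k Kk.
suff sz : stab z by rewrite -(subrK z (e i k)); exact: stabD.
(* This element of [stab] differs from [z] by an element of [K (J z)], so the choice of [J] puts [z]
   itself in [stab]. *)
apply: HJ => //; exists (z - e i k); split; last first.
  rewrite addrAC subrr add0r; apply/KN/eK.
  by apply: Kanti Kj; exact: leq_bigmax_seq.
by rewrite -opprB; exact: stabN.
Qed.

Lemma stab_open : exists j, (n <= j)%N /\ K j `<=` stab.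
Proof.
have [J HJ] := choice stab_open_factor.
exists (maxn n (\max_i J i))%N; split; first exact: leq_maxl.
move=> k Kk; have Kn : K n k by apply: Kanti Kk; exact: leq_maxl.
rewrite [k]sum_e; elim/big_ind: _ => [|h l|i _].
- exact: stab0.
- exact: stabD.
apply: HJ => //; apply: Kanti Kk.
by rewrite (leq_trans _ (leq_maxr _ _))// (leq_bigmax i).
Qed.

Lemma open_tube_component : open V.
Proof.
have [j [nj Hj]] := stab_open.
rewrite openE => y Vy; apply/nbhs_localP.
have [x Mx [s [k [se Kk yE]]]] := tube_component_sub Vy.
have Hk : stab k by apply/(tube_component_boxP Mx se Kk); rewrite -yE.
(* With this radius the total flow time from [x] stays below [eps], and membership in [V] depends on
   the [K n] part alone. *)
exists j, (eps - `|s|); split; first by rewrite subr_gt0.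
move=> t l te Kl.
have -> : y + phi t + l = x + phi (s + t) + (k + l).
  by rewrite yE raddfD !addrA (addrAC _ k (phi t)).
have Hkl : stab (k + l) by apply: stabD => //; exact: Hj.
apply/tube_component_boxP => //; last exact: (proj1 Hkl).
by rewrite (le_lt_trans (ler_normD _ _))// addrC -ltrBrDr.
Qed.

End Component.

Lemma connected_open_neighborhood (M U : set G) :
  M !=set0 -> compact M -> connected M ->
  (forall i x, exists2 y, M y & e i y = e i x) ->
  open U -> M `<=` U ->
  exists V, [/\ open V, connected V, M `<=` V & V `<=` U].
Proof.
move=> [x0 Mx0] kM cM fullM oU MU.
have [n [eps [eps0 HU]]] := compact_box_subset kM oU MU.
exists (tube_component M x0 n eps); split.
- exact: open_tube_component.
- exact: component_connected.
- exact: sub_tube_component.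
- by move=> y /tube_component_sub[x Mx]; exact: HU.
Qed.

End LocalProduct.

(** * The exponential of the circle *)

Section CircleExponential.
Variable R : realType.
Implicit Types (t : R) (z : R[i]).

(** The factor [pi *+ 2] makes the kernel the integers. *)
Definition expi t : R[i] := cos (pi *+ 2 * t) +i* sin (pi *+ 2 * t).

Lemma expi0 : expi 0 = 1.
Proof. by rewrite /expi mulr0 cos0 sin0. Qed.

Lemma expiD s t : expi (s + t) = expi s * expi t.
Proof.
rewrite /expi mulrDr cosD sinD; apply/eqP; rewrite eq_complex /= eqxx /=.
by rewrite addrC.
Qed.

Lemma expiX t n : expi t ^+ n = expi (t *+ n).
Proof.
by elim: n => [|n IH]; rewrite ?expi0// exprS IH -expiD -mulrS.
Qed.

Lemma norm_expi t : `|expi t| = 1.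
Proof. by rewrite normc_def /= cos2Dsin2 sqrtr1. Qed.

Lemma expiB s t : expi (s - t) = expi s / expi t.
Proof.
apply: (canRL (mulfK _)); first by rewrite -normr_eq0 norm_expi oner_eq0.
by rewrite -expiD subrK.
Qed.

Lemma expi_eq1 t : expi t = 1 -> exists a : int, t = a%:~R.
Proof.
have expi_int (a : int) : expi a%:~R = 1.
  have E n : expi n%:R = 1.
    rewrite -expiX; suff -> : expi 1 = 1 by rewrite expr1n.
    by rewrite /expi mulr1 cos2pi sin2pi.
  case: a => n; first exact: E.
  rewrite NegzE mulrNz; have := expiD n.+1%:R (- n.+1%:R).
  by rewrite subrr expi0 E mul1r => <-.
move=> t1; exists (Num.floor t).
have /andP[f0 f1] := floor_itv t.
set u := t - (Num.floor t)%:~R.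
have u0 : 0 <= u by rewrite subr_ge0.
have u1 : u < 1 by rewrite ltrBlDl -[ltRHS]intrD1.
have pi0 := pi_gt0 R.
have /(congr1 (@complex.Re R)) : expi u = 1.
  by rewrite expiD t1 mul1r -mulrNz expi_int.
(* By the double angle formula the sine of [pi * u] vanishes, while [pi * u] lies in [0, pi), where
   the only zero is 0. *)
rewrite /= (_ : pi *+ 2 * u = (pi * u) *+ 2); last by rewrite mulrnAl.
rewrite cos_mulr2n cos2sin2 => /eqP.
rewrite (_ : _ == 1 = (sin (pi * u) == 0)); last first.
  by rewrite -[RHS]sqrf_eq0; apply/eqP/eqP; lra.
move=> /eqP su; have [u00|/eqP un0] := eqVneq u 0.
  by apply/eqP; rewrite -subr_eq0; apply/eqP.
have /sin_gt0_pi : 0 < pi * u < pi.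
  by rewrite mulr_gt0//= ?gtr_pMr// lt_neqAle eq_sym u0 andbT; apply/eqP.
by rewrite su ltxx.
Qed.

Lemma expi_near0 (eps : R) : 0 < eps ->
  \forall t \near 0, `|1 - expi t| < eps%:C.
Proof.
move=> e0; have e20 : 0 < eps / 2 by rewrite divr_gt0.
have c2 : {for (0 : R), continuous (fun t : R => pi *+ 2 * t)}.
  exact: mulrl_continuous.
have cc : cos (pi *+ 2 * t) @[t --> 0] --> (1 : R).
  rewrite -[X in _ --> X]cos0 -[X in _ --> cos X](mulr0 (pi *+ 2)).
  by apply: (continuous_comp c2); exact: continuous_cos.
have cs : sin (pi *+ 2 * t) @[t --> 0] --> (0 : R).
  rewrite -[X in _ --> X]sin0 -[X in _ --> sin X](mulr0 (pi *+ 2)).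
  by apply: (continuous_comp c2); exact: continuous_sin.
near=> t.
have c1 : `|1 - cos (pi *+ 2 * t)| < eps / 2.
  by near: t; move/cvgrPdist_lt: cc; exact.
have s1 : `|0 - sin (pi *+ 2 * t)| < eps / 2.
  by near: t; move/cvgrPdist_lt: cs; exact.
have -> : 1 - expi t =
    (1 - cos (pi *+ 2 * t))%:C + (0 - sin (pi *+ 2 * t))%:C * 'i.
  apply/eqP; rewrite eq_complex /=.
  by rewrite !(mul0r, mulr0, mulr1, subr0, addr0, add0r) !eqxx.
apply: le_lt_trans (ler_normD _ _) _; rewrite normrM.
rewrite !normc_def/= !expr0n/= !addr0 !add0r expr1n sqrtr1 mulr1 !sqrtr_sqr.
rewrite -raddfD ltcR.
by rewrite [eps]splitr ltrD// -sub0r.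
Unshelve. all: by end_near. Qed.

(** A local logarithm: closeness to 1 bounds the real part below by a cosine, so its arccosine is
    small; the sign of the imaginary part gives the sign of [t]. *)
Lemma arc_near1 (eps : R) : 0 < eps ->
  \forall z \near (1 : R[i]^o), `|z| = 1 -> exists t, `|t| < eps /\ z = expi t.
Proof.
(* The bound 1/2 keeps [pi *+ 2 * d] in [0, pi], where the cosine is strictly decreasing. *)
move=> e0; pose d : R := Num.min eps 2^-1.
have d0 : 0 < d by rewrite lt_min e0/= invr_gt0.
have d12 : d <= 2^-1 by rewrite ge_min lexx orbT.
have pi0 := pi_gt0 R.
have p20 : 0 < pi *+ 2 :> R by rewrite mulrn_wgt0.
have dpi : 0 < pi *+ 2 * d <= pi.
  rewrite mulr_gt0//= mulrnAl -mulrnAr -[leRHS]mulr1 ler_pM2l//.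
  by rewrite -mulr_natr -ler_pdivlMr// mul1r.
have h0 : 0 < (1 - cos (pi *+ 2 * d))%:C :> R[i].
  rewrite ltcR subr_gt0 -[ltRHS]cos0 ltr_cos ?in_itv/= ?lexx ?(ltW pi0)//.
    by case/andP: dpi.
  by case/andP: dpi => /ltW-> ->.
have : \forall z \near (1 : R[i]^o), `|1 - z| < (1 - cos (pi *+ 2 * d))%:C.
  exact: (nbhsx_ballx (1 : R[i]^o) _ h0).
apply: filterS => -[a b] zd z1.
have ab : a ^+ 2 + b ^+ 2 = 1.
  apply: complexI; have := add_Re2_Im2 (a +i* b) => /= ->.
  by rewrite z1 expr1n.
have ca : cos (pi *+ 2 * d) < a.
  have := le_lt_trans (normc_ge_Re _) zd; rewrite ltcR /= => /ltr_normlW.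
  by rewrite ltrD2l ltrN2.
have a1 : -1 <= a <= 1.
  have : a ^+ 2 <= 1 by rewrite -ab lerDl sqr_ge0.
  rewrite -[leRHS](expr1n _ 2) -ler_norml -[X in X <= _]real_normK ?num_real//.
  by rewrite ler_pXn2r ?nnegrE.
have aI : cos (acos a) = a by rewrite acosK// in_itv.
have th0 := acos_ge0 a1; have thpi := acos_lepi a1.
have thd : acos a < pi *+ 2 * d.
  rewrite -ltr_cos ?in_itv/= ?th0 ?thpi ?aI//.
  by case/andP: dpi => /ltW-> ->.
have sI : sin (acos a) = `|b|.
  by rewrite sin_acos// -sqrtr_sqr -ab addrAC subrr add0r.
have p2 : pi *+ 2 != 0 :> R by rewrite gt_eqF.
have td : acos a / (pi *+ 2) < eps.
  rewrite ltr_pdivrMr // mulrC (lt_le_trans thd)// ler_pM2l//.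
  by rewrite ge_min lexx.
have t0 : 0 <= acos a / (pi *+ 2) by rewrite divr_ge0// ltW.
have [b0|b0] := leP 0 b.
  exists (acos a / (pi *+ 2)); rewrite ger0_norm//; split=> //.
  by rewrite /expi mulrC divfK// aI sI ger0_norm.
exists (- (acos a / (pi *+ 2))); rewrite normrN ger0_norm//; split=> //.
by rewrite /expi mulrN mulrC divfK// cosN sinN aI sI ltr0_norm// opprK.
Qed.

(** Dividing the time by [p] at each index produces a point of the [p]-adic solenoid. *)
Lemma expi_root t p k : (0 < p)%N ->
  expi (t / (p ^ k.+1)%:R) ^+ p = expi (t / (p ^ k)%:R).
Proof.
move=> p0; rewrite expiX; congr expi.
rewrite -(mulr_natr (_ / _)) -mulrA expnSr natrM invfM.
by rewrite [_^-1 * _]mulrC mulrAC mulVf ?mul1r// pnatr_eq0 -lt0n.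
Qed.

End CircleExponential.

(** * The group structure and the topology of a product of solenoids *)

Section SolenoidProduct.
Variables (R : realType) (r : nat) (m : 'I_r -> nat).

Definition solprod : Type := prod_topology (fun i : 'I_r => solenoid R (m i)).

HB.instance Definition _ := Topological.copy solprod
  (prod_topology (fun i : 'I_r => solenoid R (m i))).

Definition coord (x : solprod) i k : R[i] := set_val (set_val (x i) k).

(** Points are built from plain complex families, which keeps the nested subtypes out of
    computations. *)
Definition coherent (f : 'I_r -> nat -> R[i]) :=
  (forall i k, `|f i k| = 1) /\ (forall i k, f i k.+1 ^+ m i = f i k).

Lemma coordP x : coherent (coord x).
Proof.
split=> i k; first exact: (set_mem (valP (set_val (x i) k))).
exact: (set_mem (valP (x i)) k).
Qed.

Lemma norm_coord x i k : `|coord x i k| = 1.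
Proof. exact: (proj1 (coordP x)). Qed.

Lemma coordX x i k : coord x i k.+1 ^+ m i = coord x i k.
Proof. exact: (proj2 (coordP x)). Qed.

Lemma coord_inj x y : (forall i k, coord x i k = coord y i k) -> x = y.
Proof.
move=> xy; apply: functional_extensionality_dep => i; apply: val_inj.
by apply: functional_extensionality_dep => k; apply: val_inj; exact: xy.
Qed.

Definition circle_point (z : R[i]) (hz : `|z| = 1) : set_type (circle R) :=
  SigSub (mem_set (hz : circle R z)).

Lemma solenoid_set_coherent f (hf : coherent f) i :
  solenoid_set R (m i) (fun k => circle_point (proj1 hf i k)).
Proof. by move=> k; exact: (proj2 hf i k). Qed.

Definition solprod_of f (hf : coherent f) : solprod :=
  fun i => SigSub (mem_set (solenoid_set_coherent hf i)).

Lemma coord_of f (hf : coherent f) i k : coord (solprod_of hf) i k = f i k.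
Proof. by []. Qed.

Lemma coherent1 : coherent (fun _ _ => 1).
Proof. by split=> i k; rewrite ?normr1 ?expr1n. Qed.

Lemma coherentV x : coherent (fun i k => (coord x i k)^-1).
Proof.
by split=> i k; rewrite ?normfV ?norm_coord ?invr1// exprVn coordX.
Qed.

Lemma coherentM x y : coherent (fun i k => coord x i k * coord y i k).
Proof.
by split=> i k; rewrite ?normrM ?norm_coord ?mulr1// exprMn !coordX.
Qed.

Lemma coord_neq0 x i k : coord x i k != 0.
Proof. by rewrite -normr_eq0 norm_coord oner_eq0. Qed.

Fact solprod_addA : associative (fun x y => solprod_of (coherentM x y)).
Proof. by move=> x y z; apply: coord_inj => i k; rewrite !coord_of mulrA. Qed.

Fact solprod_addC : commutative (fun x y => solprod_of (coherentM x y)).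
Proof. by move=> x y; apply: coord_inj => i k; rewrite !coord_of mulrC. Qed.

Fact solprod_add0 :
  left_id (solprod_of coherent1) (fun x y => solprod_of (coherentM x y)).
Proof. by move=> x; apply: coord_inj => i k; rewrite !coord_of mul1r. Qed.

Fact solprod_addN : left_inverse (solprod_of coherent1)
  (fun x => solprod_of (coherentV x)) (fun x y => solprod_of (coherentM x y)).
Proof.
by move=> x; apply: coord_inj => i k; rewrite !coord_of mulVf// coord_neq0.
Qed.

HB.instance Definition _ := GRing.isZmodule.Build solprod
  solprod_addA solprod_addC solprod_add0 solprod_addN.

Lemma coord0 i k : coord 0 i k = 1. Proof. by []. Qed.
Lemma coordD x y i k : coord (x + y) i k = coord x i k * coord y i k.
Proof. by []. Qed.
Lemma coordN x i k : coord (- x) i k = (coord x i k)^-1.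
Proof. by []. Qed.

Lemma coord_mulrn x N i k : coord (x *+ N) i k = coord x i k ^+ N.
Proof.
by elim: N => [|N IH]; rewrite ?coord0// mulrS exprS coordD IH.
Qed.

Lemma coord_sum (I : Type) (s : seq I) (P : pred I) (F : I -> solprod) i k :
  coord (\sum_(j <- s | P j) F j) i k = \prod_(j <- s | P j) coord (F j) i k.
Proof. by apply: (big_morph (fun x => coord x i k)). Qed.

Lemma coordX_add x i k l : coord x i (k + l) ^+ (m i ^ l) = coord x i k.
Proof.
by elim: l => [|l IH]; rewrite ?addn0 ?expr1// addnS expnS exprM coordX.
Qed.

(** Coordinates of index below [n] are powers of those at [n], so they are 1 too and the subgroups
    decrease. *)
Definition level n : set solprod := [set x | forall i, coord x i n = 1].

Lemma level_le n k : (n <= k)%N -> level k `<=` level n.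
Proof.
by move=> /subnKC <- x xk i; rewrite -(coordX_add _ _ _ (k - n)) xk expr1n.
Qed.

Lemma coherent_factor i x :
  coherent (fun j k => if j == i then coord x j k else 1).
Proof.
by split=> j k; case: eqP => _; rewrite ?norm_coord ?normr1 ?coordX ?expr1n.
Qed.

Definition factor i x : solprod := solprod_of (coherent_factor i x).

Lemma factor_is_zmod_morphism i : zmod_morphism (factor i).
Proof.
move=> x y; apply: coord_inj => j k.
rewrite coordD coordN !coord_of.
by case: eqP => // _; rewrite invr1 mulr1.
Qed.

HB.instance Definition _ i :=
  GRing.isZmodMorphism.Build solprod solprod (factor i)
    (factor_is_zmod_morphism i).

Lemma factor_level i n x : level n x -> level n (factor i x).
Proof. by move=> xn j; rewrite coord_of xn if_same. Qed.

Lemma sum_factor x : x = \sum_i factor i x.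
Proof.
apply: coord_inj => j k; rewrite coord_sum (bigD1 j)//= coord_of eqxx.
by rewrite big1 ?mulr1// => i; rewrite coord_of eq_sym => /negPf->.
Qed.

Lemma coprime_prodr n (I : Type) (s : seq I) (P : pred I) (F : I -> nat) :
  (forall i, P i -> coprime n (F i)) -> coprime n (\prod_(i <- s | P i) F i).
Proof.
move=> nF; elim/big_ind: _ => // [|x y nx ny]; first exact: coprimen1.
by rewrite coprimeMr nx.
Qed.

Lemma factor_mulrn i n k x : (forall i j, i != j -> coprime (m i) (m j)) ->
  level n x -> exists N, level k (factor i x - x *+ N).
Proof.
move=> co xn.
(* Coordinate 0 of [x] is 1, so coordinate [k] is a root of unity of order dividing [m j ^ k]. *)
have x1 j : coord x j k ^+ (m j ^ k) = 1.
  by rewrite (coordX_add x j 0 k); exact: (level_le (leq0n n) xn).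
pose P := (\prod_(j | j != i) m j ^ k)%N.
have coP : coprime (m i ^ k) P.
  by apply: coprime_prodr => j ji; rewrite coprimeXl// coprimeXr// co// eq_sym.
(* This number is 1 modulo [m i ^ k] and 0 modulo every other [m j ^ k]. *)
exists (chinese (m i ^ k) P 1 0) => j.
rewrite coordD coordN coord_mulrn coord_of.
have [->|ji] := eqVneq j i.
  rewrite -(expr_mod _ (x1 i)) chinese_modl// expr_mod// expr1 divff//.
  exact: coord_neq0.
rewrite mul1r -(expr_mod _ (x1 j)) (_ : (_ %% _ = 0)%N) ?expr0 ?invr1//.
apply/eqP; rewrite -/(dvdn _ _).
apply: (@dvdn_trans P); first by rewrite /P (bigD1 j)//= dvdn_mulr.
by rewrite /dvdn chinese_modr// mod0n.
Qed.

(** * The flow and the local product structure *)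

Hypothesis m_gt0 : forall i, (0 < m i)%N.

Lemma mX_neq0 i k : (m i ^ k)%:R != 0 :> R.
Proof. by rewrite pnatr_eq0 -lt0n expn_gt0 m_gt0. Qed.

Lemma coherent_flow (s : 'rV[R]_r) :
  coherent (fun i k => expi (s 0 i / (m i ^ k)%:R)).
Proof.
by split=> i k; [exact: norm_expi|exact: expi_root].
Qed.

Definition flow s : solprod := solprod_of (coherent_flow s).

Lemma coord_flow s i k : coord (flow s) i k = expi (s 0 i / (m i ^ k)%:R).
Proof. by []. Qed.

Lemma flow_is_zmod_morphism : zmod_morphism flow.
Proof.
move=> s t; apply: coord_inj => i k; rewrite coordD coordN.
by rewrite !coord_flow !mxE mulrBl expiB.
Qed.

HB.instance Definition _ :=
  GRing.isZmodMorphism.Build 'rV[R]_r solprod flow flow_is_zmod_morphism.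

(** Level [n] forces the [i]-th time to be an integer multiple of [m i ^ n], and a bounded time
    leaves finitely many multiples. *)
Lemma factor_flow_finite i n (A : R) : exists F : seq solprod,
  forall s : 'rV[R]_r, `|s| < A -> level n (factor i (flow s)) ->
  factor i (flow s) \in F.
Proof.
pose N := Num.bound `|A|.
(* Only entry [i] survives [factor i], so a constant row will do. *)
pose z (a : int) : solprod := factor i (flow (const_mx (a%:~R * (m i ^ n)%:R))).
(* The shift by [N] lists the integers from [-N] to [N]. *)
exists [seq z (a%:Z - N%:Z) | a <- iota 0 (N + N).+1] => s sA /(_ i).
rewrite coord_of eqxx coord_flow => /expi_eq1[a aE].
have sE : s 0 i = a%:~R * (m i ^ n)%:R by rewrite -aE divfK// mX_neq0.
have aN : `|a| <= N%:Z.
  rewrite -(ler_int R) intr_norm; apply: (@le_trans _ _ `|s 0 i|).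
    by rewrite sE normrM ler_peMr// normr_nat ler1n expn_gt0 m_gt0.
  apply: (@le_trans _ _ `|s|); last first.
    rewrite (le_trans (ltW sA))// (le_trans (ler_norm A))// -pmulrn.
    by rewrite ltW// archi_boundP.
  exact: row_entry_le_norm.
apply/mapP; exists (absz (a + N%:Z)).
  by rewrite mem_iota; lia.
have -> : (absz (a + N%:Z))%:Z - N%:Z = a by lia.
apply: coord_inj => j k; rewrite !coord_of.
by case: eqP => // ->; rewrite !mxE sE.
Qed.

Lemma continuous_coord i k : continuous (fun x => coord x i k : R[i]^o).
Proof.
move=> x; apply: (@continuous_comp solprod (solenoid R (m i)) R[i]^o
  (fun x => x i) (fun y => set_val (set_val y k))).
  exact: proj_continuous.
apply: (@continuous_comp (solenoid R (m i)) {ptws nat -> set_type (circle R)}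
  R[i]^o set_val (fun z => set_val (z k))); first exact: initial_continuous.
apply: (@continuous_comp {ptws nat -> set_type (circle R)}
  (set_type (circle R)) R[i]^o (fun z => z k) set_val).
  exact: proj_continuous.
exact: initial_continuous.
Qed.

Lemma cvg_solprod (F : set_system solprod) (x : solprod) : Filter F ->
  (forall i k, (coord y i k : R[i]^o) @[y --> F] --> (coord x i k : R[i]^o)) ->
  F --> x.
Proof.
move=> FF Fx; apply: cvg_prod_topology => i.
apply: cvg_initial_topology; apply: cvg_prod_topology => k.
by apply: cvg_initial_topology; exact: Fx.
Qed.

Lemma solprod_nbhsP (x : solprod) (O : set solprod) : nbhs x O <->
  exists n (eps : R), 0 < eps /\
    forall (s : 'rV[R]_r) k, `|s| < eps -> level n k -> O (x + flow s + k).
Proof.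
split; last first.
  move=> [n [eps [e0 HO]]].
  (* For [y] near [x], the quotient at index [n] lies on a short arc; a flow time undoes it, and
     what remains is in [level n]. *)
  pose near_arc i y := exists t,
    `|t| < eps / (m i ^ n)%:R /\ coord y i n / coord x i n = expi t.
  have : \forall y \near x, forall i, near_arc i y.
    apply: (@filter_forall _ _ near_arc (nbhs x)) => i.
    have d0 : 0 < eps / (m i ^ n)%:R by rewrite divr_gt0// ltr0n expn_gt0 m_gt0.
    have c :
        (coord y i n / coord x i n : R[i]^o) @[y --> x] --> (1 : R[i]^o).
      apply/(@cvgrPdist_lt R[i] R[i]^o _ _ (nbhs_filter x)) => a a0.
      have /(@cvgrPdist_lt R[i] R[i]^o _ _ (nbhs_filter x))/(_ a a0) :=
        @continuous_coord i n x.
      apply: filterS => y.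
      suff -> : `|coord x i n - coord y i n| =
          `|1 - coord y i n / coord x i n| by [].
      rewrite -[LHS]mulr1 -[X in _ * X = _](norm_coord (- x) i n) coordN.
      by rewrite -normrM mulrBl divff ?coord_neq0.
    apply: (@filterS _ _ (nbhs_filter x) _ _ _ (c _ (arc_near1 d0))) => y.
    apply.
    by rewrite normrM normfV !norm_coord divr1.
  apply: filterS => y /choice[t Ht].
  (* The flow divides by [m i ^ n] at index [n], so this time moves that coordinate by exactly
     [expi (t i)]. *)
  pose s : 'rV[R]_r := \row_i (t i * (m i ^ n)%:R).
  have -> : y = x + flow s + (y - (x + flow s)) by rewrite addrC subrK.
  apply: HO => [|i].
    rewrite /Num.norm/= mx_normrE; apply/bigmax_ltP; split=> // -[a i] _ /=.
    rewrite mxE normrM normr_nat -ltr_pdivlMr ?ltr0n ?expn_gt0 ?m_gt0//.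
    by have [] := Ht i.
  rewrite coordD coordN coordD coord_flow mxE mulfK ?mX_neq0//.
  have [_ <-] := Ht i.
  by rewrite mulrCA divff ?coord_neq0// mulr1 divff// coord_neq0.
(* For the other direction, the sets containing a box form a filter, whose convergence to [x] can be
   checked on coordinates. *)
pose F : set_system solprod := [set O | exists n (eps : R), 0 < eps /\
    forall (s : 'rV[R]_r) k, `|s| < eps -> level n k -> O (x + flow s + k)].
have FF : Filter F.
  split.
  - by exists 0%N, 1.
  - move=> P Q [n [d [d0 HP]]] [k [e [e0 HQ]]].
    exists (maxn n k), (Num.min d e); split; first by rewrite lt_min d0.
    move=> s l; rewrite lt_min => /andP[sd se] Kl.
    split; [apply: HP|apply: HQ] => //; apply: level_le Kl.
      exact: leq_maxl.
    exact: leq_maxr.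
  - move=> P Q PQ [n [d [d0 HP]]]; exists n, d; split=> // s l sd Kl.
    exact/PQ/HP.
suff : F --> x by apply.
apply: cvg_solprod => i k; apply/(@cvgrPdist_lt R[i] R[i]^o _ _ FF) => e e0.
(* A positive element of [R[i]] is real, so it yields a real radius. *)
have eE : e = (complex.Re e)%:C by rewrite RRe_real// gtr0_real.
have r0 : 0 < complex.Re e by rewrite -ltcR -eE.
have /nbhs_ballP[d /= d0 Hd] := expi_near0 r0.
(* At index [k] elements of [level k] contribute 1, so only the flow moves the coordinate, and
   division by [m i ^ k] only shortens its time. *)
exists k, d; split=> // s l sd Kl /=.
rewrite !coordD coord_flow Kl mulr1 -[X in X - _]mulr1 -mulrBr normrM.
rewrite norm_coord mul1r.
rewrite eE; apply: Hd; rewrite /ball/= sub0r normrN normrM.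
apply: le_lt_trans sd; rewrite normfV normr_nat.
apply: (@le_trans _ _ `|s 0 i|).
  by rewrite ler_piMr// invf_le1 ?ltr0n ?ler1n expn_gt0 m_gt0.
exact: row_entry_le_norm.
Qed.

End SolenoidProduct.

(** * Application to products of solenoids *)

Theorem theorem6 (R : realType) (r : nat) (m : 'I_r -> nat)
    (m_gt1 : forall i, (1 < m i)%N)
    (m_coprime : forall i j, i != j -> coprime (m i) (m j)) :
  fupcon R (fun i : 'I_r => solenoid R (m i)).
Proof.
have m_gt0 i : (0 < m i)%N := ltnW (m_gt1 i).
move=> M U [M0 cM conM _] oU MU fullM.
apply: (@connected_open_neighborhood R r (solprod R m) (flow m_gt0)
  (@level R r m) (@factor R r m)) => //.
- by move=> n x y xn yn i; rewrite coordD coordN xn yn divr1.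
- exact: level_le.
- exact: solprod_nbhsP.
- exact: factor_level.
- exact: sum_factor.
- by move=> i n k h; exact: factor_mulrn.
- exact: factor_flow_finite.
(* Full projection gives a point of [M] with the same [i]-th component as [x], hence the same image
   under [factor i]. *)
- move=> i x; have [y My yx] : (proj i @` M) (x i) by rewrite fullM.
  exists y => //; apply: coord_inj => j k; rewrite !coord_of.
  by case: eqP => // ->; rewrite /coord -yx.
Qed.
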